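(* Let $n\ge 1$, $\alpha_0,\dots,\alpha_{n-1}\in\mathbb{D}$ and $\lambda\in\partial\mathbb{D}$. Let $w_1,\dots,w_{n+1}$ be the zeros of the POPUC $\Phi_{n+1}(z;\lambda)$, let $\eta_j$ be the normalized eigenvector of $U_\lambda$ with eigenvalue $w_j$, let $d\mu=\sum_{j=1}^{n+1}|\langle\eta_j,1\rangle|^2\delta_{w_j}$ (the measure for which $\varphi_0,\dots,\varphi_n$ are the orthonormal polynomials, with Verblunsky coefficients $\alpha_0,\dots,\alpha_{n-1}$), and let $d\nu=\sum_{j=1}^{n+1}|\langle\eta_j,\varphi_n\rangle|^2\delta_{w_j}$. Then the Verblunsky coefficients of $d\nu$ are $$\alpha_j(d\nu)=-\lambda\,\overline{\alpha_{n-1-j}},\quad j=0,\dots,n-1;\qquad \alpha_n(d\nu)=\lambda.$$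
   Context: $\mathbb{D}$ is the open unit disk. For a polynomial $P$ regarded as having degree $k$, $P^*(z)=z^k\overline{P(1/\bar z)}$. Given $\alpha_0,\dots,\alpha_{n-1}\in\mathbb{D}$, define monic polynomials by $\Phi_0=1$ and Szegő recursion $\Phi_{j+1}(z)=z\Phi_j(z)-\overline{\alpha_j}\,\Phi_j^*(z)$, $0\le j\le n-1$. Put $\rho_j=\sqrt{1-|\alpha_j|^2}$ and $\varphi_j=\Phi_j/(\rho_0\cdots\rho_{j-1})$. For $\lambda\in\partial\mathbb{D}$ the paraorthogonal polynomial (POPUC) is $\Phi_{n+1}(z;\lambda)=z\Phi_n(z)-\bar\lambda\,\Phi_n^*(z)$; it has $n+1$ distinct zeros $w_j$, all on $\partial\mathbb{D}$. There is a unique probability measure $d\mu$ supported exactly on these zeros for which $\varphi_0,\dots,\varphi_n$ are orthonormal in $L^2(\partial\mathbb{D},d\mu)$. $U_\lambda$ is the unitary operator of multiplication by $z$ on the $(n+1)$-dimensional space $L^2(\partial\mathbb{D},d\mu)$, identified with polynomials of degree at most $n$; its eigenvalues are the $w_j$, with normalized eigenvectors $\eta_j(z)=N_j^{-1}\Phi_{n+1}(z;\lambda)/(z-w_j)$, $N_j>0$. Verblunsky coefficients of a probability measure $d\nu$ on $\partial\mathbb{D}$ supported on exactly $n+1$ points: let $\Phi_j(\cdot;d\nu)$, $0\le j\le n$, be the monic orthogonal polynomials in $L^2(\partial\mathbb{D},d\nu)$ (Gram–Schmidt on $1,z,\dots,z^n$) and let $\Phi_{n+1}(z;d\nu)=\prod(z-w)$,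 the product over the $n+1$ support points $w$. Then $\alpha_j(d\nu)=-\overline{\Phi_{j+1}(0;d\nu)}$ for $0\le j\le n$, so that $\Phi_{j+1}=z\Phi_j-\overline{\alpha_j}\Phi_j^*$; the first $n$ lie in $\mathbb{D}$ and the last in $\partial\mathbb{D}$. *)

(* Defs.v *)
From HB Require Import structures.
From mathcomp Require Import all_boot all_order all_algebra.

Set Implicit Arguments.
Unset Strict Implicit.
Unset Printing Implicit Defensive.

Import Order.TTheory GRing.Theory Num.Theory.
Local Open Scope ring_scope.

(* The definitions are over an arbitrary numClosedFieldType;
   the complex numbers are the instance C := R[i] with R : realType.  In such a
   C, 0 < x entails that x is real. *)

Section Szego.
Variables (C : numClosedFieldType) (alpha : nat -> C).

(* P^*(z) = z^k conj(P(1 / conj z)), for P regarded as having degree k: the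
   coefficients of P are conjugated and listed in reverse order. *)
Definition reversed (k : nat) (P : {poly C}) : {poly C} :=
  \poly_(i < k.+1) (P`_(k - i))^*.

Definition szego_step (k : nat) (a : C) (P : {poly C}) : {poly C} :=
  'X * P - a^* *: reversed k P.

Fixpoint Phi (j : nat) : {poly C} :=
  if j is i.+1 then szego_step i (alpha i) (Phi i) else 1.

Definition rho (j : nat) : C := sqrtC (1 - `|alpha j| ^+ 2).

Definition phi (j : nat) : {poly C} := (\prod_(i < j) rho i)^-1 *: Phi j.

Definition popuc (n : nat) (lambda : C) : {poly C} :=
  szego_step n lambda (Phi n).

(* Multiplication by z on L^2(dmu), where mu is carried by the n + 1 distinct
   zeros of the POPUC and L^2(dmu) is identified with the polynomials of degree
   at most n: the remainder is the polynomial of degree at most n that agrees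
   with z * P(z) at every zero. *)
Definition U_op (n : nat) (lambda : C) (P : {poly C}) : {poly C} :=
  ('X * P) %% popuc n lambda.

End Szego.

(* The measure \sum_(i < N) mass i * delta_(atom i). *)
Record atomic_measure (C : Type) (N : nat) := AtomicMeasure {
  atom : 'I_N -> C;
  mass : 'I_N -> C
}.

Section Measure.
Variables (C : numClosedFieldType) (N : nat) (mu : atomic_measure C N).

(* mu is a probability measure on the unit circle whose support consists of
   exactly N points. *)
Definition circle_probability : Prop :=
  [/\ injective (atom mu), forall i, `|atom mu i| = 1,
      forall i, 0 < mass mu i & \sum_i mass mu i = 1].

(* Inner product of L^2(dmu), antilinear in the first argument. *)
Definition dot (P Q : {poly C}) : C :=
  \sum_i mass mu i * ((P.[atom mu i])^* * Q.[atom mu i]).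

Definition gram_schmidt_step (s : seq {poly C}) (k : nat) : {poly C} :=
  'X^k - \sum_(Q <- s) (dot Q 'X^k / dot Q Q) *: Q.

Fixpoint gram_schmidt (k : nat) : seq {poly C} :=
  if k is j.+1 then
    rcons (gram_schmidt j) (gram_schmidt_step (gram_schmidt j) j)
  else [::].

(* Monic orthogonal polynomials of degrees 0, ..., N - 1, completed in degree N
   by the polynomial vanishing on the support (no meaning for j > N). *)
Definition monic_op (j : nat) : {poly C} :=
  if (j < N)%N then gram_schmidt_step (gram_schmidt j) j
  else \prod_i ('X - (atom mu i)%:P).

Definition verblunsky (j : nat) : C := - ((monic_op j.+1).[0])^*.

(* The measure \sum_i |<eta i, P>|^2 delta_(atom i). *)
Definition spectral_measure (eta : 'I_N -> {poly C}) (P : {poly C}) :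
    atomic_measure C N :=
  AtomicMeasure (atom mu) (fun i => `|dot (eta i) P| ^+ 2).

End Measure.

(* Any phase is allowed for eta; the choice
   eta(z) = N^-1 popuc(z) / (z - w), N > 0, is one of them. *)
Definition normalized_eigenvector (C : numClosedFieldType) (alpha : nat -> C)
    (n : nat) (lambda : C) (mu : atomic_measure C n.+1) (w : C)
    (eta : {poly C}) : Prop :=
  [/\ (size eta <= n.+1)%N, dot mu eta eta = 1
    & U_op alpha n lambda eta = w *: eta].

(* Main.v *)
Require Import Defs.
From HB Require Import structures.
From mathcomp Require Import all_boot all_order all_algebra.
From mathcomp Require Import reals complex.
From mathcomp Require Import ring.

Set Implicit Arguments.
Unset Strict Implicit.
Unset Printing Implicit Defensive.

Import Order.TTheory GRing.Theory Num.Theory.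
Local Open Scope ring_scope.

(* The eigenvector of w_j vanishes at the other atoms, so
   |<eta_j, P>|^2 = mu{w_j} |P(w_j)|^2 and dnu = |phi_n|^2 dmu.  Let Psi_j be
   the monic polynomials of the coefficients -lambda conj(alpha_(n-1-j)).
   Running the Szego recursion of mu backwards from level n, where the POPUC
   equation fixes the ratio of Phi_n to Phi_n^*, gives at each atom
     Psi_j Phi_n = c_j conj(lambda) z^(n-1) conj(Phi_(n-j)),  c_j constant.
   Hence <Psi_i, Psi_j>_nu is a multiple of <Psi_i Phi_(n-j), Phi_n>_mu, which
   vanishes for i < j by degree, so the Psi_j are the monic orthogonal
   polynomials of nu. *)

(** * Szegő recursion and its values on the unit circle *)

Section SzegoPolynomials.
Variables (C : numClosedFieldType) (alpha : nat -> C).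

Lemma size_reversed k (P : {poly C}) : (size (reversed k P) <= k.+1)%N.
Proof. exact: size_poly. Qed.

Lemma szego_step_monic k a (P : {poly C}) :
  P \is monic -> size P = k.+1 ->
  szego_step k a P \is monic /\ size (szego_step k a P) = k.+2.
Proof.
move=> mP sP; rewrite /szego_step.
have sX : size ('X * P) = k.+2 by rewrite size_monicM ?monicX ?monic_neq0 // size_polyX sP.
have lt_size : (size (- (a^* *: reversed k P)) < size ('X * P)%R)%N.
  by rewrite size_polyN sX ltnS (leq_trans (size_scale_leq _ _)) ?size_reversed.
split; last by rewrite size_polyDl.
by rewrite monicE lead_coefDl // lead_coefM lead_coefX mul1r -monicE.
Qed.

Lemma Phi_monic_size j : Phi alpha j \is monic /\ size (Phi alpha j) = j.+1.
Proof.
elim: j => [|j [mP sP]] /=; first by rewrite monic1 size_poly1.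
exact: szego_step_monic.
Qed.

(** The constant term of the reversed polynomial is the conjugate leading coefficient, here 1. This
    is how a Verblunsky coefficient is read off at 0. *)
Lemma szego_step0 k a (P : {poly C}) :
  P \is monic -> size P = k.+1 -> (szego_step k a P).[0] = - a^*.
Proof.
move=> mP sP.
have lead1 : P`_k = 1 by move: (monicP mP); rewrite lead_coefE sP.
rewrite /szego_step !hornerE horner_coef0 coef_poly subn0 lead1 /=.
by rewrite conjC1 mulr1.
Qed.

(** On the circle [z^*] is the inverse of [z], so reversing the coefficients amounts to conjugating
    the value, up to the factor [z ^+ k]. *)
Lemma reversed_circle k (P : {poly C}) (z : C) :
  (size P <= k.+1)%N -> `|z| = 1 -> (reversed k P).[z] = z ^+ k * (P.[z])^*.
Proof.
move=> sP z1.
have zz : z * z^* = 1 by rewrite -normCK z1 expr1n.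
rewrite horner_poly (horner_coef_wide _ sP) rmorph_sum mulr_sumr /=.
rewrite (reindex_inj rev_ord_inj) /=; apply: eq_bigr => i _.
have le_ik : (i <= k)%N by rewrite -ltnS.
rewrite subSS subKn // rmorphM rmorphXn /= mulrCA; congr (_ * _).
have -> : z ^+ k = z ^+ (k - i) * z ^+ i by rewrite -exprD subnK.
by rewrite -mulrA -exprMn zz expr1n mulr1.
Qed.

Lemma szego_step_circle k a (P : {poly C}) (z : C) :
  (size P <= k.+1)%N -> `|z| = 1 ->
  (szego_step k a P).[z] = z * P.[z] - a^* * (z ^+ k * (P.[z])^*).
Proof.
move=> sP z1.
by rewrite /szego_step hornerD hornerN hornerZ hornerM hornerX reversed_circle.
Qed.

Lemma PhiS_circle j (z : C) : `|z| = 1 ->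
  (Phi alpha j.+1).[z] =
    z * (Phi alpha j).[z] - (alpha j)^* * (z ^+ j * ((Phi alpha j).[z])^*).
Proof.
have [_ sP] := Phi_monic_size j.
by move=> z1; rewrite [LHS]szego_step_circle ?sP.
Qed.

(** At a zero of the next polynomial, taking norms in the recursion gives
    [|Phi n| = |alpha n| |Phi n|], impossible when [Phi n] is nonzero and [|alpha n| < 1]. It makes
    the masses of nu positive. *)
Lemma Phi_circle_neq0 n (z : C) :
  (forall j, (j < n)%N -> `|alpha j| < 1) -> `|z| = 1 ->
  (Phi alpha n).[z] != 0.
Proof.
move=> alpha1 z1; elim: n alpha1 => [|n IH] alpha1.
  by rewrite /= hornerE oner_neq0.
have Pz : (Phi alpha n).[z] != 0 by apply: IH => j jn; exact/alpha1/ltnW.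
apply/eqP; rewrite PhiS_circle // => /eqP; rewrite subr_eq0 => /eqP/(congr1 Num.norm).
rewrite !normrM normrX !norm_conjC z1 expr1n !mul1r => eqP.
have := alpha1 n (ltnSn n).
by rewrite -(ltr_pM2r (_ : 0 < `|(Phi alpha n).[z]|)) ?normr_gt0 // -eqP mul1r ltxx.
Qed.

End SzegoPolynomials.

(** * Uniqueness of monic orthogonal polynomials for a finitely supported measure *)

Section InnerProduct.
Variables (C : numClosedFieldType) (N : nat) (mu : atomic_measure C N).

Lemma dotDl P Q F : dot mu (P + Q) F = dot mu P F + dot mu Q F.
Proof.
rewrite /dot -big_split; apply: eq_bigr => i _ /=.
by rewrite hornerD rmorphD mulrDl mulrDr.
Qed.

Lemma dotZl c P F : dot mu (c *: P) F = c^* * dot mu P F.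
Proof.
rewrite /dot mulr_sumr; apply: eq_bigr => i _.
by rewrite hornerZ rmorphM /=; ring.
Qed.

Lemma dotBr F P Q : dot mu F (P - Q) = dot mu F P - dot mu F Q.
Proof.
rewrite /dot -sumrB; apply: eq_bigr => i _.
by rewrite hornerD hornerN mulrBr mulrBr.
Qed.

Lemma dotZr c F P : dot mu F (c *: P) = c * dot mu F P.
Proof.
rewrite /dot mulr_sumr; apply: eq_bigr => i _.
by rewrite hornerZ; ring.
Qed.

Lemma dot_sumr (I : Type) (r : seq I) F (G : I -> {poly C}) :
  dot mu F (\sum_(k <- r) G k) = \sum_(k <- r) dot mu F (G k).
Proof.
rewrite /dot exchange_big; apply: eq_bigr => i _ /=.
by rewrite horner_sum !mulr_sumr.
Qed.

Lemma dot_span (p : nat -> {poly C}) F j (Q : {poly C}) :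
  (forall i, p i \is monic /\ size (p i) = i.+1) ->
  (forall i, (i < j)%N -> dot mu (p i) F = 0) ->
  (size Q <= j)%N -> dot mu Q F = 0.
Proof.
move=> p_monic; elim: j Q => [|j IH] Q pF sQ.
  rewrite (_ : Q = 0 *: Q) ?dotZl ?conjC0 ?mul0r //.
  by rewrite scale0r; apply/eqP; rewrite -size_poly_leq0.
have [mp sp] := p_monic j.
rewrite -(subrK (Q`_j *: p j) Q) dotDl dotZl pF // mulr0 addr0.
apply: IH => [i ij|]; first exact/pF/ltnW.
have pj1 : (p j)`_j = 1 by move: (monicP mp); rewrite lead_coefE sp.
apply/leq_sizeP => k; rewrite leq_eqVlt coefB coefZ => /predU1P[<-|jk].
  by rewrite pj1 mulr1 subrr.
have Qk : Q`_k = 0 by rewrite nth_default // (leq_trans sQ).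
by rewrite Qk (nth_default _ (_ : (size (p j) <= k)%N)) ?sp // mulr0 subrr.
Qed.

Hypothesis mu_prob : circle_probability mu.

Lemma dotC P Q : dot mu Q P = (dot mu P Q)^*.
Proof.
have [_ _ mass_gt0 _] := mu_prob.
rewrite /dot rmorph_sum; apply: eq_bigr => i _ /=.
by rewrite !rmorphM /= conjCK (CrealP (gtr0_real (mass_gt0 i))) [_^* * _]mulrC.
Qed.

(** All masses are positive, so a null vector vanishes at [N] distinct atoms, too many for a nonzero
    polynomial of degree below [N]. *)
Lemma dot_eq0 (P : {poly C}) : (size P <= N)%N -> dot mu P P = 0 -> P = 0.
Proof.
have [inj_w _ mass_gt0 _] := mu_prob.
move=> sP /eqP; rewrite psumr_eq0 => [/allP P0|i _]; last first.
  by rewrite [_^* * _]mulrC mulr_ge0 ?mul_conjC_ge0 // ltW.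
apply/eqP; apply/negPn/negP => Pn0.
have := @max_poly_roots _ P [seq atom mu i | i : 'I_N] Pn0.
rewrite size_map size_enum_ord ltnNge sP => /(_ _ _)/negP; case=> //; last first.
  by rewrite map_inj_uniq ?enum_uniq.
apply/allP => _ /mapP[i _ ->]; have := P0 i (mem_index_enum i).
by rewrite [_^* * _]mulrC mulf_eq0 gt_eqF ?mass_gt0 //= mul_conjC_eq0.
Qed.

Lemma monic_op_unique (p : nat -> {poly C}) :
  (forall i, p i \is monic /\ size (p i) = i.+1) ->
  (forall i j, (i < j < N)%N -> dot mu (p i) (p j) = 0) ->
  forall j, (j < N)%N -> monic_op mu j = p j.
Proof.
move=> p_monic p_orth.
have p_orth_neq i j : (i < N)%N -> (j < N)%N -> i != j -> dot mu (p i) (p j) = 0.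
  move=> iN jN; rewrite neq_ltn => /orP[ij|ji]; first by rewrite p_orth ?ij.
  by rewrite dotC p_orth ?ji // conjC0.
(* The leading terms cancel in the difference of the two monic polynomials. That difference is
   orthogonal to each [p i] with [i < j], hence to itself, hence zero. *)
have step j : (j < N)%N -> gram_schmidt_step mu (mkseq p j) j = p j.
  move=> jN; apply/eqP; rewrite -subr_eq0; apply/eqP.
  pose T i := (dot mu (p i) 'X^j / dot mu (p i) (p i)) *: p i.
  pose S := \sum_(i < j) T i.
  have -> : gram_schmidt_step mu (mkseq p j) j = 'X^j - S.
    by rewrite /S -(big_mkord xpredT T) /index_iota subn0 /gram_schmidt_step big_map.
  have sD : (size ('X^j - S - p j)%R <= j)%N.
    have [mp sp] := p_monic j.
    have pj1 : (p j)`_j = 1 by move: (monicP mp); rewrite lead_coefE sp.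
    have sS : (size S <= j)%N.
      apply: (leq_trans (size_sum _ _ _)); apply/bigmax_leqP => i _.
      by rewrite (leq_trans (size_scale_leq _ _)) //; have [_ ->] := p_monic i.
    apply/leq_sizeP => k jk; rewrite !coefB coefXn (nth_default _ (leq_trans sS jk)).
    rewrite subr0; move: jk; rewrite leq_eqVlt => /predU1P[<-|jk].
      by rewrite eqxx pj1 subrr.
    by rewrite gtn_eqF // (nth_default _ (_ : (size (p j) <= k)%N)) ?sp // subrr.
  apply: dot_eq0; first exact: leq_trans sD (ltnW jN).
  apply: (dot_span p_monic _ sD) => i ij.
  have iN := ltn_trans ij jN.
  have pp_neq0 : dot mu (p i) (p i) != 0.
    apply/eqP => /dot_eq0; have [mp ->] := p_monic i => /(_ iN) p0.
    by move: (monic_neq0 mp); rewrite p0 eqxx.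
  rewrite !dotBr p_orth ?ij // subr0 dot_sumr.
  rewrite (bigD1 (Ordinal ij)) //= big1 ?addr0 => [|k ki].
    by rewrite /T dotZr divfK // subrr.
  have kN := ltn_trans (ltn_ord k) jN.
  by rewrite /T dotZr (p_orth_neq i k) ?mulr0 // eq_sym.
have gs j : (j <= N)%N -> gram_schmidt mu j = mkseq p j.
  elim: j => [|j IH] jN //=.
  by rewrite IH ?(ltnW jN) // step // /mkseq -addn1 iotaD map_cat cats1.
by move=> j jN; rewrite /monic_op jN gs ?step // ltnW.
Qed.

End InnerProduct.

(** * Spectral measures of the POPUC and the reversed coefficients *)

Section Spectral.
Variables (C : numClosedFieldType) (alpha : nat -> C) (n : nat) (lambda : C).
Hypothesis lambda1 : `|lambda| = 1.

Lemma popuc_circle (z : C) : `|z| = 1 -> root (popuc alpha n lambda) z ->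
  z * (Phi alpha n).[z] = lambda^* * (z ^+ n * ((Phi alpha n).[z])^*).
Proof.
move=> z1; have [_ sP] := Phi_monic_size alpha n.
by rewrite /root /popuc szego_step_circle ?sP // subr_eq0 => /eqP.
Qed.

Lemma eigenvector_mass (mu : atomic_measure C n.+1) (eta : 'I_n.+1 -> {poly C}) P j :
  circle_probability mu ->
  (forall i, root (popuc alpha n lambda) (atom mu i)) ->
  (forall i, normalized_eigenvector alpha lambda mu (atom mu i) (eta i)) ->
  mass (spectral_measure mu eta P) j = mass mu j * `|P.[atom mu j]| ^+ 2.
Proof.
move=> [inj_w _ mass_gt0 _] root_w eta_eigen; have [_ eta1 eta_w] := eta_eigen j.
(* Evaluating the Euclidean division of ['X * eta j] at another atom, where the POPUC vanishes,
   leaves [(w_i - w_j) * eta_j(w_i) = 0]. *)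
have eta0 i : i != j -> (eta j).[atom mu i] = 0.
  move=> ij; have /(congr1 (fun p => p.[atom mu i])) :=
    divp_eq ('X * eta j) (popuc alpha n lambda).
  rewrite [_ %% _]eta_w hornerM hornerX hornerD hornerM hornerZ.
  rewrite (rootP (root_w i)) mulr0 add0r => /eqP.
  rewrite -subr_eq0 -mulrBl mulf_eq0 subr_eq0 (inj_eq inj_w) (negPf ij).
  by move/eqP.
have dotE Q : dot mu (eta j) Q = mass mu j * (((eta j).[atom mu j])^* * Q.[atom mu j]).
  rewrite /dot (bigD1 j) //= big1 ?addr0 // => i ij.
  by rewrite eta0 // conjC0 mul0r mulr0.
(* Normalization fixes the modulus of [eta j] at its own atom; its phase disappears in the squared
   modulus. *)
have mass_eta : mass mu j * `|(eta j).[atom mu j]| ^+ 2 = 1.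
  by rewrite normCK -eta1 dotE [_^* * _]mulrC.
rewrite /= dotE !normrM norm_conjC (gtr0_norm (mass_gt0 j)) -[RHS]mul1r -mass_eta.
by ring.
Qed.

(** For [j >= n] the truncated index is 0; polynomials of degree at most [n] involve only
    [j < n]. *)
Definition dual_verblunsky j : C := - lambda * (alpha (n.-1 - j)%N)^*.

(** Induction on [j]: a forward step for the new coefficients matches an inverse Szegő step from
    level [n - j], each contributing a factor [1 - |alpha i|^2]. The extra factor [z] on both sides
    avoids the exponent [n - 1]. *)
Lemma dual_Phi j (z : C) : `|z| = 1 -> root (popuc alpha n lambda) z -> (j <= n)%N ->
  z * ((Phi dual_verblunsky j).[z] * (Phi alpha n).[z]) =
  \prod_(n - j <= i < n) (1 - `|alpha i| ^+ 2) *
    (lambda^* * (z ^+ n * ((Phi alpha (n - j)).[z])^*)).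
Proof.
move=> z1 root_z; have popuc_z := popuc_circle z1 root_z.
have zz : z * z^* = 1 by rewrite -normCK z1 expr1n.
have ll : lambda * lambda^* = 1 by rewrite -normCK lambda1 expr1n.
have z0 : z != 0 by rewrite -normr_eq0 z1 oner_neq0.
elim: j => [|j IH] jn.
  by rewrite subn0 big_geq // mul1r -[Phi dual_verblunsky 0]polyC1 hornerC mul1r.
have {}IH := IH (ltnW jn).
set i := (n - j.+1)%N; have ij : (n - j = i.+1)%N by rewrite /i -subSn.
have nE : n = (j + i.+1)%N by rewrite -ij subnKC // ltnW.
have alpha_i : dual_verblunsky j = - lambda * (alpha i)^*.
  by rewrite /dual_verblunsky /i subnS -subn1 -subnDA add1n subnS.
move: IH; rewrite ij => IH.
rewrite (big_ltn (_ : (i < n)%N)) ?leq_subr //; last first.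
  by rewrite nE addnS ltnS leq_addl.
set r := \prod_(_ <= _ < _) _ in IH *.
have r_real : r^* = r.
  rewrite rmorph_prod; apply: eq_bigr => k _ /=.
  by rewrite rmorphB rmorph1 normCK rmorphM /= conjCK [_^* * _]mulrC.
move: IH popuc_z; rewrite !PhiS_circle // alpha_i [in `|_| ^+ 2]normCK.
set A := (Phi dual_verblunsky j).[z]; set P := (Phi alpha n).[z].
set F := (Phi alpha i).[z].
rewrite !(rmorphB, rmorphM, rmorphN, rmorphXn) /= !conjCK => IH popuc_z.
have zzX k : z ^+ k * z^* ^+ k = 1 by rewrite -exprMn zz expr1n.
(* The right side is [r] times the value of [Phi alpha i.+1]. Conjugating [IH] produces [A^* * P^*],
   and the POPUC equation trades [P^*] for [P]. *)
have AcP : A^* * P = r * (z * F - (alpha i)^* * (z ^+ i * F^*)).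
  have /(congr1 Num.conj) := IH.
  rewrite !(rmorphB, rmorphM, rmorphN, rmorphXn) /= !conjCK r_real => IHc.
  apply: (mulfI z0).
  transitivity (lambda^* * z ^+ n * z * (z^* * (A^* * P^*))).
    transitivity (A^* * (lambda^* * (z ^+ n * P^*)) * (z * z^*)); last by ring.
    by rewrite zz mulr1 -popuc_z; ring.
  rewrite IHc.
  transitivity (lambda * lambda^* * (z ^+ n * z^* ^+ n) *
    (z * (r * (z * F - (alpha i)^* * (z ^+ i * F^*))))); first by ring.
  by rewrite ll zzX !mul1r.
have zn : z ^+ n = z ^+ j * z ^+ i * z by rewrite nE addnS exprSr exprD.
transitivity (z * (z * (A * P)) + lambda^* * alpha i * z ^+ j.+1 * (A^* * P)).
  by rewrite exprS; ring.
rewrite IH AcP zn exprS.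
transitivity (r * lambda^* * (z ^+ j * z ^+ i * z * (z * z^*) * F^*
   - alpha i * z ^+ j * z * z * (z ^+ i * z^* ^+ i) * F)
   + lambda^* * alpha i * (z * z ^+ j) * (r * (z * F - (alpha i)^* * (z ^+ i * F^*)))).
  by ring.
(* The terms in [F] cancel, and those in [F^*] combine to the new factor [1 - |alpha i|^2]. *)
by rewrite zz zzX; ring.
Qed.

Lemma dual_Phi_orthogonal (mu nu : atomic_measure C n.+1) (c : C) :
  circle_probability mu ->
  (forall i, root (popuc alpha n lambda) (atom mu i)) ->
  (forall k, (k < n)%N -> dot mu (Phi alpha k) (Phi alpha n) = 0) ->
  atom nu = atom mu ->
  (forall l, mass nu l = mass mu l * (c * `|(Phi alpha n).[atom mu l]| ^+ 2)) ->
  forall i j, (i < j <= n)%N ->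
    dot nu (Phi dual_verblunsky i) (Phi dual_verblunsky j) = 0.
Proof.
move=> [_ w1 _ _] root_w orth_n nu_atom nu_mass i j /andP[ij jn].
set r := \prod_(n - j <= k < n) (1 - `|alpha k| ^+ 2).
transitivity (c * r * dot mu (Phi dual_verblunsky i * Phi alpha (n - j)) (Phi alpha n)).
  rewrite /dot mulr_sumr; apply: eq_bigr => l _.
  rewrite nu_atom nu_mass hornerM rmorphM /= normCK.
  have := dual_Phi (w1 l) (root_w l) jn; have := popuc_circle (w1 l) (root_w l).
  have z0 : atom mu l != 0 by rewrite -normr_eq0 w1 oner_neq0.
  rewrite -/r; move: (atom mu l) z0 => z z0.
  set P := (Phi alpha n).[z]; set A := (_ i).[z]; set B := (_ j).[z].
  set F := (Phi alpha (n - j)).[z] => popuc_z dual_z.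
  (* The factor [z] lets both identities apply: [dual_z] replaces [B * P] by a multiple of [F^*],
     then [popuc_z] turns the remaining [P^*] back into [P]. *)
  apply: (mulfI z0).
  transitivity (mass mu l * c * A^* * P^* * (z * (B * P))); first by ring.
  rewrite dual_z.
  transitivity (mass mu l * c * A^* * r * F^* * (lambda^* * (z ^+ n * P^*))).
    by ring.
  by rewrite -popuc_z; ring.
have [mi si] := Phi_monic_size dual_verblunsky i.
have [mj sj] := Phi_monic_size alpha (n - j).
rewrite (dot_span (Phi_monic_size alpha) orth_n) ?mulr0 //.
rewrite size_monicM ?monic_neq0 // si sj addnS /= addSn.
(* The product has degree [i + (n - j)], which is below [n] because [i < j]. *)
by rewrite -[X in (_ <= X)%N](subnKC jn) -addSn leq_add2r.
Qed.

Lemma popuc_prod (w : 'I_n.+1 -> C) :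
  injective w -> (forall i, root (popuc alpha n lambda) (w i)) ->
  \prod_i ('X - (w i)%:P) = popuc alpha n lambda.
Proof.
move=> inj_w root_w; have [mP sP] := Phi_monic_size alpha n.
have [mQ sQ] := szego_step_monic lambda mP sP.
rewrite -(big_map w xpredT (fun z => 'X - z%:P)) /=.
rewrite [RHS](@all_roots_prod_XsubC _ _ [seq w i | i <- index_enum 'I_n.+1]).
- by rewrite (monicP mQ) scale1r.
- by rewrite [size _ in LHS]sQ size_map /index_enum unlock -enumT size_enum_ord.
- by apply/allP => _ /mapP[i _ ->]; apply: root_w.
- by rewrite uniq_rootsE map_inj_uniq // index_enum_uniq.
Qed.

End Spectral.

Theorem theorem7 (R : realType) (n : nat) (alpha : nat -> R[i]) (lambda : R[i])
    (w m : 'I_n.+1 -> R[i]) (eta : 'I_n.+1 -> {poly R[i]}) :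
  (1 <= n)%N ->
  (forall j, (j < n)%N -> `|alpha j| < 1) ->
  `|lambda| = 1 ->
  injective w ->
  (forall z, root (popuc alpha n lambda) z <-> exists j, w j = z) ->
  let mu := AtomicMeasure w m in
  circle_probability mu ->
  (forall j k, (j <= n)%N -> (k <= n)%N ->
     dot mu (phi alpha j) (phi alpha k) = (j == k)%:R) ->
  (forall j, normalized_eigenvector alpha lambda mu (w j) (eta j)) ->
  let nu := spectral_measure mu eta (phi alpha n) in
  [/\ forall j, mass mu j = mass (spectral_measure mu eta 1) j,
      circle_probability nu,
      forall j, (j < n)%N ->
        verblunsky nu j = - lambda * (alpha (n.-1 - j)%N)^*
    & verblunsky nu n = lambda].
Proof.
move=> _ alpha1 lambda1 inj_w root_w mu mu_prob phi_orth eta_eigen nu.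
have root_mu i : root (popuc alpha n lambda) (atom mu i) by apply/root_w; exists i.
have mass_eta P j := eigenvector_mass P j mu_prob root_mu eta_eigen.
have [_ w1 mass_gt0 _] := mu_prob.
have prod_rho_neq0 k : (k <= n)%N -> \prod_(i < k) rho alpha i != 0.
  move=> kn; apply/prodf_neq0 => i _; rewrite sqrtC_eq0 subr_eq0 eq_sym.
  by rewrite lt_eqF // expr_lt1 // alpha1 // (leq_trans (ltn_ord i)).
have Phi_orth k : (k < n)%N -> dot mu (Phi alpha k) (Phi alpha n) = 0.
  move=> kn; have := phi_orth k n (ltnW kn) (leqnn n).
  rewrite ltn_eqF // dotZl dotZr => /eqP; rewrite !mulf_eq0 conjC_eq0 !invr_eq0.
  by rewrite !(negPf (prod_rho_neq0 _ _)) ?(ltnW kn) //= => /eqP.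
have nu_prob : circle_probability nu.
  split=> [//|//|i|]; rewrite -/nu.
    rewrite mass_eta mulr_gt0 // exprn_gt0 // normr_gt0 hornerZ mulf_neq0 //.
      by rewrite invr_eq0 prod_rho_neq0.
    exact: Phi_circle_neq0 (w1 i).
  (* The total mass of nu is the squared norm of [phi alpha n] in L^2(dmu). *)
  rewrite -[RHS](_ : dot mu (phi alpha n) (phi alpha n) = 1); last first.
    by rewrite phi_orth // eqxx.
  by apply: eq_bigr => i _; rewrite mass_eta normCK [_^* * _]mulrC.
pose c := `|(\prod_(i < n) rho alpha i)^-1| ^+ 2.
have nu_mass l : mass nu l = mass mu l * (c * `|(Phi alpha n).[atom mu l]| ^+ 2).
  by rewrite mass_eta hornerZ normrM exprMn.
have Psi_orth :=
  dual_Phi_orthogonal (nu := nu) lambda1 mu_prob root_mu Phi_orth erefl nu_mass.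
have op_nu := monic_op_unique nu_prob (Phi_monic_size (dual_verblunsky alpha n lambda)).
split=> // [j|j jn|].
- by rewrite mass_eta -polyC1 hornerC normr1 expr1n mulr1.
(* The coefficient of index [j] sits in the polynomial of degree [j.+1], still at most [n], so
   uniqueness applies. *)
- rewrite /verblunsky op_nu //.
  have [mP sP] := Phi_monic_size (dual_verblunsky alpha n lambda) j.
  by rewrite (szego_step0 _ mP sP) rmorphN /= opprK conjCK.
(* In degree [n.+1] the polynomial is the product over the atoms; nu has the atoms of mu, so this is
   the POPUC and its constant term gives [lambda]. *)
- have [mP sP] := Phi_monic_size alpha n.
  rewrite /verblunsky /monic_op ltnn (popuc_prod inj_w root_mu).
  by rewrite (szego_step0 _ mP sP) rmorphN /= opprK conjCK.
Qed.
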